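(* Every quasi-o-minimal theory satisfies the following condition (R): for all $A\subseteq\mathfrak C$ and all $p\in S_1(A)$, every equivalence relation $E\in\mathcal E_p$ is relatively $0$-definable.
   Context: $T$ is a complete one-sorted first-order theory with monster model $\mathfrak C$; parameter sets are small. $T$ is quasi-o-minimal if there is a $0$-definable linear order $<$ on $\mathfrak C$ such that every parametrically definable subset of $\mathfrak C$ is a finite Boolean combination of $0$-definable sets and intervals with endpoints in $\mathfrak C\cup\{\pm\infty\}$. For $p\in S_1(A)$, $p(\mathfrak C)$ is its set of realizations; a set $X\subseteq p(\mathfrak C)^n$ is relatively $B$-definable if $X=\phi(\mathfrak C)\cap p(\mathfrak C)^n$ for some $L_B$-formula $\phi$ (relatively $0$-definable if $B=\emptyset$). $\mathcal E_p$ is the set of all relatively $A$-definable equivalence relations on $p(\mathfrak C)$. *)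

(* Defs.v *)
From mathcomp Require Import all_boot.
From mathcomp Require Import boolp classical_sets functions cardinality.

Set Implicit Arguments.
Unset Strict Implicit.
Unset Printing Implicit Defensive.

Local Open Scope classical_set_scope.

Record signature := Signature {
  fsym : Type;
  far : fsym -> nat;
  rsym : Type;
  rar : rsym -> nat }.

(* [term L n] and [formula L n] have their free variables among x_0, ...,
   x_{n-1}.  [All] binds x_0 of its body, shifting x_i of the quantified
   formula to x_{i+1}. *)
Inductive term (L : signature) (n : nat) : Type :=
| Var of 'I_n
| App (f : fsym L) of ('I_(far f) -> term L n).

Inductive formula (L : signature) : nat -> Type :=
| Fls n : formula L n
| Eq n of term L n & term L n : formula L n
| Rel n (r : rsym L) of ('I_(rar r) -> term L n) : formula L n
| Imp n of formula L n & formula L n : formula L n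
| All n of formula L n.+1 : formula L n.

Definition Not L n (phi : formula L n) : formula L n := Imp phi (Fls L n).

Definition sentence (L : signature) : Type := formula L 0.

Record structure (L : signature) := Structure {
  carrier :> Type;
  carrier_inhabited : inhabited carrier;
  fint : forall f : fsym L, ('I_(far f) -> carrier) -> carrier;
  rint : forall r : rsym L, ('I_(rar r) -> carrier) -> Prop }.

Definition env_cons (M : Type) n (a : M) (e : 'I_n -> M) : 'I_n.+1 -> M :=
  fun i => if unlift ord0 i is Some j then e j else a.

Fixpoint eval L (M : structure L) n (e : 'I_n -> M) (t : term L n) : M :=
  match t with
  | Var i => e i
  | App f ts => fint (fun i => eval e (ts i))
  end.

Fixpoint sat L (M : structure L) n (phi : formula L n) : ('I_n -> M) -> Prop :=
  match phi in formula _ n return ('I_n -> M) -> Prop with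
  | Fls _ => fun _ => False
  | Eq _ t u => fun e => eval e t = eval e u
  | Rel _ r ts => fun e => rint (fun i => eval e (ts i))
  | Imp _ phi psi => fun e => sat phi e -> sat psi e
  | All _ phi => fun e => forall a : M, sat phi (env_cons a e)
  end.

Definition holds L (M : structure L) (phi : sentence L) : Prop :=
  forall e : 'I_0 -> M, sat phi e.

Definition theory (L : signature) : Type := set (sentence L).

Definition models L (M : structure L) (T : theory L) : Prop :=
  forall phi, T phi -> holds M phi.

Definition entails L (T : theory L) (phi : sentence L) : Prop :=
  forall M : structure L, models M T -> holds M phi.

Definition complete_theory L (T : theory L) : Prop :=
  (exists M : structure L, models M T) /\
  (forall phi, entails T phi \/ entails T (Not phi)).

(* L_A: the language L with a new constant for each element of A. *)
Definition expand_sig L (M : structure L) (A : set M) : signature :=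
  @Signature (fsym L + {a : M | A a})%type
    (fun s => match s with inl f => far f | inr _ => 0 end)
    (rsym L) (@rar L).

Definition expand L (M : structure L) (A : set M) :
    structure (expand_sig A) :=
  @Structure (expand_sig A) M (carrier_inhabited M)
    (fun s => match s return ('I_(@far (expand_sig A) s) -> M) -> M with
              | inl f => @fint L M f
              | inr a => fun _ => sval a
              end)
    (fun r => @rint L M r).

Definition formula_over L (M : structure L) (A : set M) (n : nat) : Type :=
  formula (expand_sig A) n.

Definition sat_over L (M : structure L) (A : set M) n
    (phi : formula_over A n) (e : 'I_n -> M) : Prop :=
  @sat (expand_sig A) (expand A) n phi e.

Definition realizes L (M : structure L) (A : set M)
    (p : set (formula_over A 1)) (a : M) : Prop :=
  forall phi, p phi -> sat_over phi (fun=> a).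

Definition finitely_satisfiable L (M : structure L) (A : set M)
    (p : set (formula_over A 1)) : Prop :=
  forall q, finite_set q -> q `<=` p -> exists a, realizes q a.

(* p \in S_1(A) *)
Definition complete_type L (M : structure L) (A : set M)
    (p : set (formula_over A 1)) : Prop :=
  finitely_satisfiable p /\ forall phi, p phi \/ p (Not phi).

(* Cardinals are represented by types. *)
Definition card_lt (X Y : Type) (A : set X) (B : set Y) : Prop :=
  (A #<= B)%card /\ ~ (B #<= A)%card.

Definition small L (kappa : Type) (M : structure L) (A : set M) : Prop :=
  card_lt A [set: kappa].

Definition saturated L (kappa : Type) (M : structure L) : Prop :=
  forall A : set M, small kappa A ->
  forall p : set (formula_over A 1), complete_type p -> exists a, realizes p a.

(* Only the values of f on A matter. *)
Definition elementary_on L (M : structure L) (A : set M) (f : M -> M) : Prop :=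
  forall n (phi : formula L n) (e : 'I_n -> M),
    (forall i, A (e i)) -> (sat phi e <-> sat phi (f \o e)).

Definition automorphism L (M : structure L) (f : M -> M) : Prop :=
  [/\ bijective f,
      forall (s : fsym L) (e : 'I_(far s) -> M), f (fint e) = fint (f \o e) &
      forall (r : rsym L) (e : 'I_(rar r) -> M), rint e <-> rint (f \o e)].

Definition strongly_homogeneous L (kappa : Type) (M : structure L) : Prop :=
  forall A : set M, small kappa A ->
  forall f : M -> M, elementary_on A f ->
  exists2 g : M -> M, automorphism g & forall a, A a -> g a = f a.

Definition monster_model L (kappa : Type) (T : theory L) (C : structure L) :
    Prop :=
  [/\ models C T,
      card_lt [set: {n & formula L n}] [set: kappa],
      saturated kappa C &
      strongly_homogeneous kappa C].

Definition definable L (M : structure L) (B : set M) n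
    (X : set ('I_n -> M)) : Prop :=
  exists phi : formula_over B n, X = [set e | sat_over phi e].

Definition relatively_definable L (M : structure L) (A : set M)
    (p : set (formula_over A 1)) (B : set M) n (X : set ('I_n -> M)) : Prop :=
  exists phi : formula_over B n,
    X = [set e | sat_over phi e] `&` [set e | forall i, realizes p (e i)].

(* Subsets of M and of M x M, as sets of 1- and 2-tuples. *)
Definition tuples1 (M : Type) (D : set M) : set ('I_1 -> M) :=
  [set e | D (e ord0)].

Definition tuples2 (M : Type) (R : M -> M -> Prop) : set ('I_2 -> M) :=
  [set e | R (e ord0) (e ord_max)].

Definition strict_linear_order (M : Type) (lt : M -> M -> Prop) : Prop :=
  [/\ forall x, ~ lt x x,
      forall x y z, lt x y -> lt y z -> lt x z &
      forall x y, [\/ lt x y, x = y | lt y x]].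

Inductive endpoint (M : Type) : Type :=
| MInf
| Fin of M
| PInf.

Arguments MInf {M}.
Arguments PInf {M}.

(* The boolean says whether a finite endpoint belongs to the interval. *)
Definition above (M : Type) (lt : M -> M -> Prop) (u : endpoint M)
    (closed : bool) (x : M) : Prop :=
  match u with
  | MInf => True
  | Fin a => lt a x \/ (closed /\ x = a)
  | PInf => False
  end.

Definition below (M : Type) (lt : M -> M -> Prop) (v : endpoint M)
    (closed : bool) (x : M) : Prop :=
  match v with
  | MInf => False
  | Fin b => lt x b \/ (closed /\ x = b)
  | PInf => True
  end.

Definition is_interval (M : Type) (lt : M -> M -> Prop) (D : set M) : Prop :=
  exists u v bu bv, D = [set x | above lt u bu x /\ below lt v bv x].

Inductive boolean_combination (M : Type) (G : set (set M)) : set M -> Prop :=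
| BC_base D of G D : boolean_combination G D
| BC_setC D of boolean_combination G D : boolean_combination G (~` D)
| BC_setU D D' of boolean_combination G D & boolean_combination G D' :
    boolean_combination G (D `|` D')
| BC_setI D D' of boolean_combination G D & boolean_combination G D' :
    boolean_combination G (D `&` D').

Definition quasi_o_minimal L (C : structure L) : Prop :=
  exists lt : C -> C -> Prop,
    [/\ strict_linear_order lt,
        definable set0 (tuples2 lt) &
        forall D : set C, definable setT (tuples1 D) ->
          boolean_combination
            [set D' | definable set0 (tuples1 D') \/ is_interval lt D'] D].

Definition equivalence_on (M : Type) (P : set M) (E : M -> M -> Prop) : Prop :=
  [/\ forall x y, E x y -> P x /\ P y,
      forall x, P x -> E x x,
      forall x y, E x y -> E y x &
      forall x y z, E x y -> E y z -> E x z].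

(* E \in \mathcal E_p *)
Definition definable_equivalence L (M : structure L) (A : set M)
    (p : set (formula_over A 1)) (E : M -> M -> Prop) : Prop :=
  equivalence_on [set a | realizes p a] E /\
  relatively_definable p A (tuples2 E).

Definition condition_R L (kappa : Type) (C : structure L) : Prop :=
  forall A : set C, small kappa A ->
  forall p : set (formula_over A 1), complete_type p ->
  forall E : C -> C -> Prop, definable_equivalence p E ->
  relatively_definable p set0 (tuples2 E).

(* Main.v *)
(** Write P for the set of realizations of p. The monster is homogeneous
    over A, so a property of points of P that is invariant under
    automorphisms fixing A holds everywhere on P or nowhere. The trace on
    P of an E-class is a finite union of convex sets; some point lies in
    the last of them, hence every point does, and E-classes are convex in
    P.
    An A-definable set D is built from 0-definable sets and intervals;
    close to the upper end of P the intervals are trivial, so there D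
    agrees with a 0-definable set D0. Automorphisms over A move any point
    between two points of P that far up, so D and D0 agree on the whole
    convex hull of P.
    If E is neither equality nor all of P x P, some point d outside P
    fills the gap just above a class. By compactness there is a formula
    theta in p such that no pair of points of theta on different sides of
    d satisfies the formula defining E, and the points d with this
    property form an A-definable set D.
    Conjugates of d in D separate all classes, so points of P are
    equivalent iff no point of D, equivalently of D0, lies strictly
    between them. *)

From mathcomp Require Import all_boot.
From mathcomp Require Import boolp classical_sets functions cardinality filter.
Require Import Defs.

Set Implicit Arguments.
Unset Strict Implicit.
Unset Printing Implicit Defensive.

Local Open Scope classical_set_scope.

(** * Translation of terms and formulas *)

Lemma env_cons0 (M : Type) n (a : M) (e : 'I_n -> M) : env_cons a e ord0 = a.
Proof. by rewrite /env_cons unlift_none. Qed.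

Lemma env_consS (M : Type) n (a : M) (e : 'I_n -> M) i :
  env_cons a e (lift ord0 i) = e i.
Proof. by rewrite /env_cons liftK. Qed.

(** Change of language and substitution of terms for variables are handled at once. It suffices that
    each function symbol of [L1], applied to terms of [L2], is expressed through [h] by some term of
    [L2]. *)
Lemma term_translation (L1 L2 : signature) (M1 : structure L1)
    (M2 : structure L2) (h : M1 -> M2) :
  (forall s n (ts : 'I_(@far L1 s) -> term L2 n),
    exists u, forall (e : 'I_n -> M2) w,
      (forall i, eval e (ts i) = h (w i)) -> eval e u = h (fint w)) ->
  forall n (t : term L1 n) k (s : 'I_n -> term L2 k),
  exists u, forall (e : 'I_k -> M2) e',
    (forall i, eval e (s i) = h (e' i)) -> eval e u = h (eval e' t).
Proof.
move=> h_fint n t k s; elim: t => [i|f ts IH]; first by exists (s i).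
have [us usP] := choice IH.
have [u uP] := h_fint _ _ us; exists u => e e' ee'.
by apply: uP => i; apply: usP.
Qed.

Lemma term_weakening (L : signature) (M : structure L) n (t : term L n) :
  exists u : term L n.+1, forall a (e : 'I_n -> M),
    eval (env_cons a e) u = eval e t.
Proof.
have [|u uP] := @term_translation L L M M id _ n t n.+1
    (fun i => Var L (lift ord0 i)).
  by move=> s m ts; exists (App ts) => e w tsw /=; congr fint; apply/funext.
by exists u => a e; apply: uP => i /=; rewrite env_consS.
Qed.

Section Translation.
Variables (L1 L2 : signature) (M1 : structure L1) (M2 : structure L2).
Variable h : M1 -> M2.
Hypothesis h_surj : forall y, exists x, h x = y.
Hypothesis h_inj : injective h.
Hypothesis h_fint : forall s n (ts : 'I_(@far L1 s) -> term L2 n),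
  exists u, forall (e : 'I_n -> M2) w,
    (forall i, eval e (ts i) = h (w i)) -> eval e u = h (fint w).
Hypothesis h_rint : forall r n (ts : 'I_(@rar L1 r) -> term L2 n),
  exists psi : formula L2 n, forall (e : 'I_n -> M2) w,
    (forall i, eval e (ts i) = h (w i)) -> (sat psi e <-> rint w).

(** Injectivity of [h] settles equations, and surjectivity lets a quantifier over [M2] range over
    the values of [h]. *)
Lemma formula_translation n (phi : formula L1 n) k (s : 'I_n -> term L2 k) :
  exists psi : formula L2 k, forall (e : 'I_k -> M2) e',
    (forall i, eval e (s i) = h (e' i)) -> (sat psi e <-> sat phi e').
Proof.
elim: phi k s => [m|m t u|m r ts|m phi IHphi psi IHpsi|m phi IH] k s.
- by exists (Fls L2 k).
- have [t' t'P] := term_translation h_fint t s.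
  have [u' u'P] := term_translation h_fint u s.
  exists (Eq t' u') => e e' ee' /=.
  by rewrite (t'P _ _ ee') (u'P _ _ ee'); split=> [/h_inj|->].
- have [us usP] := choice (fun i => term_translation h_fint (ts i) s).
  have [psi psiP] := h_rint us; exists psi => e e' ee'.
  by apply: psiP => i; apply: usP.
- have [phi' phi'P] := IHphi k s; have [psi' psi'P] := IHpsi k s.
  exists (Imp phi' psi') => e e' ee' /=.
  by rewrite (phi'P _ _ ee') (psi'P _ _ ee').
have [s' s'P] := choice (fun i => term_weakening M2 (s i)).
(* Under the quantifier the bound variable goes to itself and the terms of [s] are weakened. *)
have [psi psiP] := IH k.+1 (fun i => if unlift ord0 i is Some j then s' j
                                     else Var L2 ord0).
have step e e' a : (forall i, eval e (s i) = h (e' i)) ->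
    (sat psi (env_cons (h a) e) <-> sat phi (env_cons a e')).
  move=> ee'; apply: psiP => i; case: (unliftP ord0 i) => [j ->|->].
    by rewrite env_consS s'P.
  by rewrite /= !env_cons0.
exists (All psi) => e e' ee' /=; split=> [H a|H b].
  by apply/(step e); last exact: H.
by have [a <-] := h_surj b; apply/(step _ e').
Qed.

End Translation.

(** * Definable sets *)

Section Definability.
Variables (L : signature) (C : structure L).

Definition eval_over (B : set C) n (t : term (expand_sig B) n) (e : 'I_n -> C)
  : C := @eval _ (expand B) n e t.

Lemma constant_term (B : set C) n b :
  B b -> exists t : term (expand_sig B) n, forall e, eval_over t e = b.
Proof.
move=> Bb; pose s : fsym (expand_sig B) := inr (exist _ b Bb).
by exists (@App _ n s (fun i : 'I_0 => False_rect _ (notF (ltn_ord i)))).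
Qed.

(** One translation both enlarges the parameter set and plugs in terms; renaming variables and
    inserting a parameter are the special cases used later. *)
Lemma definable_substitution (B B' : set C) n k (X : set ('I_n -> C))
    (s : 'I_n -> term (expand_sig B') k) :
  B `<=` B' -> definable B X ->
  definable B' [set e | X (fun i => eval_over (s i) e)].
Proof.
move=> BB' [phi ->].
have [||psi psiP] := @formula_translation (expand_sig B) (expand_sig B')
  (expand B) (expand B') (fun x => x) (fun y => ex_intro _ y erefl)
  (fun _ _ => id) _ _ n phi k s.
- case=> [f|[b Bb]] m ts.
    exists (@App (expand_sig B') m (inl f) ts) => e w tsw /=.
    by congr fint; apply/funext.
  have [t tP] := @constant_term B' m b (BB' _ Bb).
  by exists t => e w _; exact: tP.
- move=> r m ts; exists (@Rel (expand_sig B') m r ts) => e w tsw /=.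
  by rewrite (_ : (fun i => _) = w)//; apply/funext.
exists psi; rewrite predeqE => e; symmetry; exact: psiP.
Qed.

Lemma definable_const (B : set C) n (Q : Prop) :
  definable B [set _ : 'I_n -> C | Q].
Proof.
have [q|nq] := pselect Q; last by exists (Fls _ n); rewrite predeqE => e; split.
by exists (Not (Fls _ n)); rewrite predeqE => e; split=> // _ [].
Qed.

Lemma definable_imp (B : set C) n (X Y : set ('I_n -> C)) :
  definable B X -> definable B Y -> definable B [set e | X e -> Y e].
Proof. by move=> [phi ->] [psi ->]; exists (Imp phi psi). Qed.

Lemma definable_setC (B : set C) n (X : set ('I_n -> C)) :
  definable B X -> definable B (~` X).
Proof.
by move=> dX; apply: (definable_imp dX (definable_const B n False)).
Qed.

Lemma definable_setI (B : set C) n (X Y : set ('I_n -> C)) :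
  definable B X -> definable B Y -> definable B (X `&` Y).
Proof.
move=> dX /definable_setC dY.
rewrite (_ : X `&` Y = ~` [set e | X e -> (~` Y) e]).
  exact/definable_setC/definable_imp.
rewrite predeqE => e; split=> [[Xe Ye] /(_ Xe)//|H].
by split; apply: contrapT => N; apply: H => // Xe.
Qed.

Lemma definable_setU (B : set C) n (X Y : set ('I_n -> C)) :
  definable B X -> definable B Y -> definable B (X `|` Y).
Proof.
move=> /definable_setC dX /definable_setC dY.
by rewrite -[X `|` Y]setCK setCU; exact/definable_setC/definable_setI.
Qed.

Lemma definable_all (B : set C) n (X : set ('I_n.+1 -> C)) :
  definable B X -> definable B [set e | forall a, X (env_cons a e)].
Proof. by move=> [phi ->]; exists (All phi). Qed.

Lemma definable_ex (B : set C) n (X : set ('I_n.+1 -> C)) :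
  definable B X -> definable B [set e | exists a, X (env_cons a e)].
Proof.
move=> /definable_setC/definable_all/definable_setC.
rewrite (_ : ~` _ = [set e | exists a, X (env_cons a e)])//.
rewrite predeqE => e; split=> [/existsNP[a /contrapT]|[a Xa] /(_ a)//].
by exists a.
Qed.

Lemma definable_app1 (B B' : set C) k (D : set C)
    (t : term (expand_sig B') k) :
  B `<=` B' -> definable B (tuples1 D) ->
  definable B' [set e | D (eval_over t e)].
Proof. by move=> BB' /(definable_substitution (fun=> t) BB'). Qed.

Lemma definable_app2 (B B' : set C) k (R : C -> C -> Prop)
    (t u : term (expand_sig B') k) :
  B `<=` B' -> definable B (tuples2 R) ->
  definable B' [set e | R (eval_over t e) (eval_over u e)].
Proof.
by move=> BB'
  /(definable_substitution (fun i => if i == ord0 then t else u) BB').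
Qed.

Lemma definable_var1 (B B' : set C) k (D : set C) (i : 'I_k) :
  B `<=` B' -> definable B (tuples1 D) -> definable B' [set e | D (e i)].
Proof. exact: (definable_app1 (Var _ i)). Qed.

Lemma definable_var2 (B B' : set C) k (R : C -> C -> Prop) (i j : 'I_k) :
  B `<=` B' -> definable B (tuples2 R) ->
  definable B' [set e | R (e i) (e j)].
Proof. exact: (definable_app2 (Var _ i) (Var _ j)). Qed.

Lemma definable_eq (B : set C) n (i j : 'I_n) :
  definable B [set e : 'I_n -> C | e i = e j].
Proof. by exists (Eq (Var _ i) (Var _ j)). Qed.

Definition pair_env (x y : C) : 'I_2 -> C := env_cons x (fun=> y).

Lemma pair_envE (e : 'I_2 -> C) : e = pair_env (e ord0) (e ord_max).
Proof.
apply/funext => i; rewrite /pair_env.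
case: (unliftP ord0 i) => [j ->|->]; last by rewrite env_cons0.
by rewrite env_consS; congr e; apply/val_inj; case: j => -[].
Qed.

Lemma pair_env0 (x y : C) : pair_env x y ord0 = x.
Proof. exact: env_cons0. Qed.

Lemma pair_env_max (x y : C) : pair_env x y ord_max = y.
Proof.
by rewrite /pair_env (_ : ord_max = lift ord0 ord0) ?env_consS//; apply/val_inj.
Qed.

(** Constants from [B] are fixed, so [g] commutes with all terms of the expanded language;
    injectivity of [g] gives equations and surjectivity gives quantifiers. *)
Lemma automorphism_sat_over (B : set C) (g : C -> C) n
    (phi : formula_over B n) e :
  automorphism g -> (forall b, B b -> g b = b) ->
  sat_over phi e <-> sat_over phi (g \o e).
Proof.
move=> [[g' gK g'K] g_fint g_rint] gB.
have g_eval k (t : term (expand_sig B) k) u :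
    eval_over t (g \o u) = g (eval_over t u).
  elim: t => [//|[f|[b Bb]] ts IH]; last by rewrite /eval_over /= gB.
  rewrite /eval_over /= g_fint; congr fint; exact/funext.
rewrite /sat_over.
elim: phi e => [m|m t u|m r ts|m phi IHphi psi IHpsi|m phi IH] e //=.
- rewrite -!/(eval_over _ _) !g_eval; split=> [->//|]; exact: (can_inj gK).
- rewrite g_rint (_ : g \o _ = fun i => eval_over (ts i) (g \o e))//.
  by apply/funext => i; rewrite g_eval.
- by rewrite IHphi IHpsi.
have shift a : g \o env_cons a e = env_cons (g a) (g \o e).
  apply/funext => i /=; case: (unliftP ord0 i) => [j ->|->].
    by rewrite !env_consS.
  by rewrite !env_cons0.
split=> H a; last by rewrite IH shift.
by rewrite -[a]g'K -shift -IH.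
Qed.

Lemma automorphism_definable (B : set C) (g : C -> C) n (X : set ('I_n -> C)) :
  automorphism g -> (forall b, B b -> g b = b) -> definable B X ->
  forall e, X e <-> X (g \o e).
Proof. by move=> ag gB [phi ->] e; exact: automorphism_sat_over. Qed.

Lemma automorphism_definable1 (B : set C) (g : C -> C) (D : set C) :
  automorphism g -> (forall b, B b -> g b = b) -> definable B (tuples1 D) ->
  forall x, D x <-> D (g x).
Proof.
move=> ag gB dD x.
exact: (automorphism_definable ag gB dD (fun=> x)).
Qed.

Lemma automorphism_definable2 (B : set C) (g : C -> C) (R : C -> C -> Prop) :
  automorphism g -> (forall b, B b -> g b = b) -> definable B (tuples2 R) ->
  forall x y, R x y <-> R (g x) (g y).
Proof.
move=> ag gB dR x y.
have := automorphism_definable ag gB dR (pair_env x y).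
by rewrite /tuples2 /= !pair_env_max !pair_env0.
Qed.

End Definability.

(** * Saturation and homogeneity *)

(** Hilbert's hotel along an injective sequence [f] in [A]: [d] goes to [f 0], every other [f n] to
    [f n.+1], and the remaining points stay. *)
Lemma card_le_setU1 (T : Type) (A : set T) (d : T) :
  infinite_set A -> (A `|` [set d] #<= A)%card.
Proof.
elim/Ppointed: T => T in A d *; first by have := no d.
move=> /infiniteP/ppcard_leP[f]; apply/pcard_leP/injfunPex.
pose hotel x := if `[< x = d >] then f 0
                else if `[< exists n, x = f n >] then f (f^-1 x).+1 else x.
have Af n : A (f n) by exact: (@funS _ _ [set: nat] A f n).
have fK : cancel f f^-1 by move=> n; rewrite funK ?inE.
have f_inj := can_inj fK.
exists hotel.
  move=> x; rewrite /hotel; case: asboolP => // xd [Ax|//].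
  by case: asboolP.
move=> x y _ _; rewrite /hotel.
case: (asboolP (x = d)) => [->|xd]; case: (asboolP (y = d)) => [->|yd] //.
- case: asboolP => [_ /f_inj//|ny fy]; by case: ny; exists 0.
- case: asboolP => [_ /f_inj//|nx fx]; by case: nx; exists 0.
case: (asboolP (exists n, x = f n)) => [[m xm]|nx];
  case: (asboolP (exists n, y = f n)) => [[n yn]|ny] //.
- by rewrite xm yn !fK => /f_inj[->].
- by move=> yE; case: ny; exists (f^-1 x).+1.
- by move=> xE; case: nx; exists (f^-1 y).+1.
Qed.

(** A finite set stays finite, hence below the infinite [kappa]; an infinite one absorbs the new
    point. *)
Lemma small_setU1 (L : signature) (kappa : Type) (C : structure L)
    (A : set C) d :
  infinite_set [set: kappa] -> small kappa A -> small kappa (A `|` [set d]).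
Proof.
move=> kinf [Ak nkA]; have [Afin|Ainf] := pselect (finite_set A).
  have Adfin : finite_set (A `|` [set d]) by rewrite finite_setU.
  split; last by move/card_le_finite => /(_ Adfin).
  apply: card_le_trans (finite_set_countable Adfin) _; exact/infiniteP.
have Ad := card_le_setU1 d Ainf; split; first exact: card_le_trans Ad Ak.
by move=> kAd; apply: nkA; exact: card_le_trans kAd Ad.
Qed.

Lemma filter_bigcap_finite (T I : Type) (D : set I) (f : I -> set T)
    (F : set_system T) :
  Filter F -> finite_set D -> (forall i, D i -> F (f i)) ->
  F (\bigcap_(i in D) f i).
Proof.
elim/Pchoice: I => I in D f * => FF Dfin DF.
rewrite -(fset_setK Dfin); apply: filter_bigI => i.
by rewrite in_fset_set// inE => /DF.
Qed.

(** * Compactness from saturation *)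

Section Saturation.
Variables (L : signature) (kappa : Type) (C : structure L).
Hypothesis C_sat : saturated kappa C.

(* The type to realize consists of the formulas whose solution sets belong to
   an ultrafilter containing the given family. *)
Lemma saturated_bigcap (B : set C) (S : set (set C)) :
  small kappa B -> (forall D, S D -> definable B (tuples1 D)) ->
  S !=set0 ->
  (forall D D', S D -> S D' -> exists2 D'', S D'' & D'' `<=` D `&` D') ->
  (forall D, S D -> D !=set0) ->
  exists a, forall D, S D -> D a.
Proof.
move=> Bk Sdef Sn0 SI SN0.
have FF := filter_from_filter Sn0 SI.
have [U [UU SU]] := ultraFilterLemma (filter_from_proper FF SN0).
pose p : set (formula_over B 1) :=
  [set phi | U [set a | sat_over phi (fun=> a)]].
have [|a pa] := C_sat Bk (p := p).
  split=> [q qfin qp|phi]; last exact: in_ultra_setVsetC.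
  have Uq := filter_bigcap_finite (@ultra_proper _ _ UU) qfin qp.
  by have [a qa] := filter_ex Uq; exists a.
exists a => D SD; have [phi phiE] := Sdef D SD.
have phiD b : sat_over phi (fun=> b) <-> D b.
  by have := congr1 (@^~ (fun=> b)) phiE; rewrite /tuples1 /= => ->.
apply/phiD/pa; apply: SU; exists D => // b; exact: (phiD b).2.
Qed.

Section TypeOver.
Variables (A : set C) (p : set (formula_over A 1)).

(** The solution set of each formula of [p] is one of the sets [D]. This recognizes realizations of
    [p] among points obtained by saturation. *)
Lemma type_definable a :
  (forall D, definable A (tuples1 D) -> realizes p `<=` D -> D a) ->
  realizes p a.
Proof.
move=> H phi pphi; apply: (H [set a | sat_over phi (fun=> a)]); last first.
  by move=> b; exact.
exists phi; rewrite predeqE => e; rewrite /tuples1 /=.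
by rewrite (_ : (fun=> e ord0) = e)//; apply/funext => i; rewrite (ord1 i).
Qed.

(** Saturation realizes types in one variable, so if every [D] contained an [R]-related pair, a pair
    of realizations of [p] would be found one coordinate at a time. *)
Lemma type_compactness (B : set C) (R : C -> C -> Prop) :
  A `<=` B -> definable B (tuples2 R) ->
  small kappa B -> (forall b, small kappa (B `|` [set b])) ->
  (forall a b, realizes p a -> realizes p b -> ~ R a b) ->
  exists D, [/\ definable A (tuples1 D), realizes p `<=` D &
    forall a b, D a -> D b -> ~ R a b].
Proof.
move=> AB dR Bk Bbk pR; apply: contrapT => noD.
pose N D := definable A (tuples1 D) /\ realizes p `<=` D.
have NT : N setT by split=> //; exact: definable_const.
have NI D D' : N D -> N D' -> N (D `&` D').
  move=> [dD pD] [dD' pD']; split; first exact: definable_setI dD dD'.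
  by move=> a pa; split; [exact: pD|exact: pD'].
(* First coordinate: [a] has an [R]-partner in every [D], where the partner may still depend on
   [D]. *)
have [||||a aP] := @saturated_bigcap B
  [set [set a | D a /\ exists2 b, D b & R a b] | D in N] Bk.
- move=> _ [D [dD _] <-].
  rewrite (_ : tuples1 _ = [set e | D (e ord0)] `&`
    [set e | exists b, (D b /\ R (e ord0) b)]); last first.
    by rewrite predeqE => e; split=> [[De [b Db Rb]]|[De [b [Db Rb]]]];
      split=> //; exists b.
  apply: definable_setI; first exact: definable_var1 AB dD.
  have := @definable_ex _ _ B 1 ([set e | D (e ord0)] `&`
    [set e | R (e (lift ord0 ord0)) (e ord0)]).
  rewrite (_ : [set e | exists _, _] = [set e | exists b, D b /\ R (e ord0) b]).
    by apply; apply: definable_setI;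
      [exact: definable_var1 AB dD|exact: definable_var2 dR].
  by rewrite predeqE => e; split=> -[b] /= H; exists b; move: H;
    rewrite !env_cons0 env_consS.
- by exists [set a | setT a /\ exists2 b, setT b & R a b]; exists setT.
- move=> _ _ [D ND <-] [D' ND' <-].
  exists [set a | (D `&` D') a /\ exists2 b, (D `&` D') b & R a b].
    by exists (D `&` D') => //; exact: NI.
  by move=> a [[Da D'a] [b [Db D'b] Rab]]; split; split=> //; exists b.
- move=> _ [D [dD pD] <-]; apply: contrapT => DR; apply: noD.
  exists D; split=> // a b Da Db Rab; apply: DR; exists a; split=> //.
  by exists b.
have pa : realizes p a.
  by apply: type_definable => D dD pD; have [] := aP _ (imageP _ (conj dD pD)).
(* Second coordinate: with [a] as a new parameter, a single partner [b] serves all [D]. *)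
have [||||b bP] := @saturated_bigcap (B `|` [set a])
  [set [set b | D b /\ R a b] | D in N] (Bbk a).
- move=> _ [D [dD _] <-].
  have [t tE] := @constant_term _ _ (B `|` [set a]) 1 a (or_intror erefl).
  rewrite (_ : tuples1 _ = [set e | D (e ord0)] `&`
    [set e | R (eval_over t e)
      (eval_over (Var (expand_sig (B `|` [set a])) ord0) e)]); last first.
    by rewrite predeqE => e; rewrite /= tE.
  have ABa : A `<=` B `|` [set a] by move=> x /AB; left.
  apply: definable_setI; first exact: definable_var1 ABa dD.
  exact: definable_app2 (@subsetUl _ _ _) dR.
- by exists [set b | setT b /\ R a b]; exists setT.
- move=> _ _ [D ND <-] [D' ND' <-]; exists [set b | (D `&` D') b /\ R a b].
    by exists (D `&` D') => //; exact: NI.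
  by move=> b [[Db D'b] Rab].
- by move=> _ [D ND <-]; have [_ [b Db Rab]] := aP _ (imageP _ ND); exists b.
have pb : realizes p b.
  by apply: type_definable => D dD pD; have [] := bP _ (imageP _ (conj dD pD)).
have [_ Rab] := bP _ (imageP _ NT).
exact: pR pa pb Rab.
Qed.

End TypeOver.

End Saturation.

(** Completeness of [p] makes [a] and [b] satisfy the same formulas over [A], so sending [a] to [b]
    and fixing [A] is elementary and extends to an automorphism. *)
Lemma type_homogeneous (L : signature) (kappa : Type) (C : structure L)
    (A : set C) (p : set (formula_over A 1)) a b :
  strongly_homogeneous kappa C -> small kappa (A `|` [set a]) ->
  complete_type p -> realizes p a -> realizes p b ->
  exists g, [/\ automorphism g, forall c, A c -> g c = c & g a = b].
Proof.
move=> C_hom Aak [_ pT] pa pb.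
have same (psi : formula_over A 1) :
    sat_over psi (fun=> a) <-> sat_over psi (fun=> b).
  have [pp|pn] := pT psi; first by split=> _; [exact: pb|exact: pa].
  by split=> H; [case: (pa _ pn)|case: (pb _ pn)].
pose f x := if `[< x = a >] then b else x.
have [|g ag gE] := C_hom _ Aak f.
  move=> n phi e eA.
  (* Entries equal to [a] become the variable and the others become constants, which turns [phi]
     into a formula over [A] in one variable. *)
  have sP i : exists t : term (expand_sig A) 1, (forall c, c = a \/ c = b ->
      eval_over t (fun=> c) = if `[< e i = a >] then c else e i).
    case: asboolP => [eia|eia]; first by exists (Var _ ord0).
    have [Aei|//] := eA i.
    by have [t tE] := @constant_term _ _ A 1 _ Aei; exists t => c _.
  have [s {}sP] := choice sP.
  have [||psi psiP] := @formula_translation L (expand_sig A) C (expand A)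
    (fun x => x) (fun y => ex_intro _ y erefl) (fun _ _ => id) _ _ n phi 1 s.
  - move=> h m ts; exists (@App (expand_sig A) m (inl h) ts) => e1 w tsw /=.
    by congr fint; apply/funext.
  - move=> r m ts; exists (@Rel (expand_sig A) m r ts) => e1 w tsw /=.
    by rewrite (_ : (fun i => _) = w)//; apply/funext.
  rewrite -(psiP (fun=> a) e); last first.
    by move=> i; rewrite -/(eval_over _ _) sP; [case: asboolP|left].
  rewrite -(psiP (fun=> b) (f \o e)); first exact: same.
  by move=> i; rewrite -/(eval_over _ _) sP//; right.
have fa : f a = b by rewrite /f asboolT.
exists g; split=> //; last by rewrite gE //; right.
move=> c Ac; rewrite gE; last by left.
(* If [a] itself lies in [A], the formula [x = a] passes from [a] to [b], so [b = a]. *)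
rewrite /f; case: asboolP => // ca; rewrite ca in Ac *.
have [t tE] := @constant_term _ _ A 1 _ Ac.
have := (same (Eq (Var _ ord0) t)).1; rewrite /sat_over /= -!/(eval_over _ _).
by rewrite !tE; apply.
Qed.

(** * Definable sets along a cut *)

Section Cut.
Variables (L : signature) (C : structure L) (lt : C -> C -> Prop).
Hypothesis lt_order : strict_linear_order lt.

(* A filter deciding every comparison with a constant trivializes all
   intervals. *)
Lemma cut_filter_definable (F : set_system C) (D : set C) :
  Filter F ->
  (forall c, F [set x | lt c x] \/ F [set x | lt x c]) ->
  boolean_combination
    [set D' | definable set0 (tuples1 D') \/ is_interval lt D'] D ->
  exists D0, definable set0 (tuples1 D0) /\ F [set x | D x <-> D0 x].
Proof.
have [lt_irr lt_tr lt_tot] := lt_order => FF Fcut.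
have Fabove u b : exists Q : Prop, F [set x | above lt u b x <-> Q].
  case: u => [|c|]; last by exists False; apply: filterE.
    by exists True; apply: filterE.
  have [Fc|Fc] := Fcut c; [exists True|exists False];
    apply: filterS Fc => x /= cx.
    by split=> // _; left.
  split=> // -[xc|[_ xc]]; last by move: cx; rewrite xc; exact: lt_irr.
  exact: lt_irr (lt_tr _ _ _ cx xc).
have Fbelow u b : exists Q : Prop, F [set x | below lt u b x <-> Q].
  case: u => [|c|]; last by exists True; apply: filterE.
    by exists False; apply: filterE.
  have [Fc|Fc] := Fcut c; [exists False|exists True];
    apply: filterS Fc => x /= cx.
    split=> // -[xc|[_ xc]]; last by move: cx; rewrite xc; exact: lt_irr.
    exact: lt_irr (lt_tr _ _ _ cx xc).
  by split=> // _; left.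
elim=> {D} [D [dD|[u [v [bu [bv ->]]]]]|D _ [D0 [dD0 FD]]
  |D D' _ [D0 [dD0 FD]] _ [D0' [dD0' FD']]
  |D D' _ [D0 [dD0 FD]] _ [D0' [dD0' FD']]].
- by exists D; split=> //; apply: filterE.
- have [Q FQ] := Fabove u bu; have [Q' FQ'] := Fbelow v bv.
  exists [set _ | Q /\ Q']; split; first exact: definable_const.
  by apply: filterS2 FQ FQ' => x /= -> ->.
- exists (~` D0); split; first exact: definable_setC.
  by apply: filterS FD => x /= DD0; rewrite /setC /= DD0.
- exists (D0 `|` D0'); split; first exact: definable_setU.
  by apply: filterS2 FD FD' => x /= DD0 DD0'; rewrite /setU /= DD0 DD0'.
- exists (D0 `&` D0'); split; first exact: definable_setI.
  by apply: filterS2 FD FD' => x /= DD0 DD0'; rewrite /setI /= DD0 DD0'.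
Qed.

Hypothesis C_qom : forall D : set C, definable setT (tuples1 D) ->
  boolean_combination
    [set D' | definable set0 (tuples1 D') \/ is_interval lt D'] D.

(** The final segments of [S] decide every comparison: a constant below some point of [S] is
    eventually passed, and any other constant bounds [S] from above. *)
Lemma definable_eventually (S : set C) (D : set C) :
  S !=set0 -> definable setT (tuples1 D) ->
  exists D0, definable set0 (tuples1 D0) /\
    exists2 s, S s & forall x b, S b -> lt s x -> lt x b -> (D x <-> D0 x).
Proof.
have [lt_irr lt_tr lt_tot] := lt_order => S0 /C_qom bcD.
(* The bound [b] keeps tails below all upper bounds of [S]. If [S] has a maximum, some tail is
   empty; the filter may be improper. *)
pose tail s := [set x | lt s x /\ exists2 b, S b & lt x b].
have FF : Filter (filter_from S tail).
  apply: filter_from_filter => // s s' Ss Ss'.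
  have [ss'|<-|s's] := lt_tot s s'.
  - exists s' => // x [s'x xb]; split; split=> //; exact: lt_tr ss' s'x.
  - by exists s.
  - exists s => // x [sx xb]; split; split=> //; exact: lt_tr s's sx.
have [|D0 [dD0 [s Ss sD]]] := cut_filter_definable FF _ bcD.
  move=> c; have [[b Sb cb]|noc] := pselect (exists2 b, S b & lt c b).
    by left; exists b => // x [bx _]; exact: lt_tr cb bx.
  right; have [s Ss] := S0; exists s => // x [_ [b Sb xb]].
  have [cb|cb|bc] := lt_tot c b; last exact: lt_tr xb bc.
    by case: noc; exists b.
  by rewrite /= cb.
exists D0; split=> //; exists s => // x b Sb sx xb.
by apply: sD; split=> //; exists b.
Qed.

(** A constant whose comparison is not decided by the sets between [U] and [V] would be a point [d]
    filling the gap. *)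
Lemma definable_gap (U V : set C) (D : set C) :
  U !=set0 -> V !=set0 -> definable setT (tuples1 D) ->
  ~ (exists d, (forall u, U u -> ~ lt d u) /\ (forall v, V v -> ~ lt v d)) ->
  exists D0, definable set0 (tuples1 D0) /\
    exists u v, [/\ U u, V v & forall x, ~ lt x u -> ~ lt v x ->
      (D x <-> D0 x)].
Proof.
have [lt_irr lt_tr lt_tot] := lt_order => [[u0 Uu0] [v0 Vv0]] /C_qom bcD nod.
have le_tr x y z : ~ lt y x -> ~ lt z y -> ~ lt z x.
  move=> yx zy zx; have [xy|xy|//] := lt_tot x y.
    by apply: zy; exact: lt_tr zx xy.
  by apply: zy; rewrite -xy.
pose between (uv : C * C) := [set x | ~ lt x uv.1 /\ ~ lt uv.2 x].
have FF : Filter (filter_from (U `*` V) between).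
  apply: filter_from_filter; first by exists (u0, v0).
  have sup u u' : U u -> U u' ->
      exists w, [/\ U w, ~ lt w u & ~ lt w u'].
    move=> Uu Uu'; have [uu'|uu'|u'u] := lt_tot u u'.
    - by exists u'; split=> // u'u; exact: lt_irr (lt_tr _ _ _ uu' u'u).
    - by exists u; rewrite -uu'.
    - by exists u; split=> // uu'; exact: lt_irr (lt_tr _ _ _ uu' u'u).
  have inf v v' : V v -> V v' ->
      exists w, [/\ V w, ~ lt v w & ~ lt v' w].
    move=> Vv Vv'; have [vv'|vv'|v'v] := lt_tot v v'.
    - by exists v; split=> // v'v; exact: lt_irr (lt_tr _ _ _ vv' v'v).
    - by exists v; rewrite -vv'.
    - by exists v'; split=> // vv'; exact: lt_irr (lt_tr _ _ _ vv' v'v).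
  move=> [u v] [u' v'] [/= Uu Vv] [/= Uu' Vv'].
  have [u1 [Uu1 u1u u1u']] := sup _ _ Uu Uu'.
  have [v1 [Vv1 vv1 v'v1]] := inf _ _ Vv Vv'.
  exists (u1, v1) => // x [/= xu1 v1x].
  by split; split; [exact: le_tr u1u xu1|exact: le_tr v1x vv1
    |exact: le_tr u1u' xu1|exact: le_tr v1x v'v1].
have [|D0 [dD0 [[u v] [/= Uu Vv] uvD]]] := cut_filter_definable FF _ bcD.
  move=> c; have [[u Uu cu]|nou] := pselect (exists2 u, U u & lt c u).
    left; exists (u, v0) => // x [/= xu _].
    by have [/xu//|->//|ux] := lt_tot x u; exact: lt_tr cu ux.
  have [[v Vv vc]|nov] := pselect (exists2 v, V v & lt v c).
    right; exists (u0, v) => // x [/= _ vx].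
    by have [xv|->//|/vx//] := lt_tot x v; exact: lt_tr xv vc.
  by case: nod; exists c; split=> w Uw cw; [case: nou|case: nov]; exists w.
exists D0; split=> //; exists u, v; split=> // x xu vx.
by apply: uvD; split.
Qed.

End Cut.

(** * Equivalence relations on a homogeneous set *)

Section ConvexEquivalence.
Variables (L : signature) (C : structure L) (A : set C) (lt : C -> C -> Prop).
Variables (P : set C) (E R : C -> C -> Prop).
Hypothesis lt_order : strict_linear_order lt.
Hypothesis lt_definable : definable set0 (tuples2 lt).
Hypothesis C_qom : forall D : set C, definable setT (tuples1 D) ->
  boolean_combination
    [set D' | definable set0 (tuples1 D') \/ is_interval lt D'] D.
Hypothesis homogeneous : forall a b, P a -> P b ->
  exists g, [/\ automorphism g, forall c, A c -> g c = c, g a = b &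
    forall x, P x <-> P (g x)].
Hypothesis R_definable : definable A (tuples2 R).
Hypothesis E_equiv : equivalence_on P E.
Hypothesis E_R : forall a b, P a -> P b -> (E a b <-> R a b).
Hypothesis compactness : forall d,
  (forall a b, P a -> P b -> ~ [/\ lt a d, lt d b & R a b]) ->
  exists D, [/\ definable A (tuples1 D), P `<=` D &
    forall a b, D a -> D b -> ~ [/\ lt a d, lt d b & R a b]].

Let E_P a b : E a b -> P a /\ P b.
Proof. by have [H _ _ _] := E_equiv; exact: H. Qed.
Let E_refl a : P a -> E a a. Proof. by have [_ H _ _] := E_equiv; exact: H. Qed.
Let E_sym a b : E a b -> E b a. Proof. by have [_ _ H _] := E_equiv; exact: H. Qed.
Let E_trans a b c : E a b -> E b c -> E a c.
Proof. by have [_ _ _ H] := E_equiv; exact: H. Qed.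

(** An automorphism fixing [A] preserves [R], and it preserves [P], hence also the trace [E] of [R]
    on [P]. *)
Lemma homogeneous_automorphism a b : P a -> P b ->
  exists g, [/\ g a = b, forall x, exists y, g y = x, forall x, P x <-> P (g x),
    forall x y, (lt x y <-> lt (g x) (g y)) /\ (E x y <-> E (g x) (g y)) &
    forall D, definable A (tuples1 D) -> forall x, D x <-> D (g x)].
Proof.
move=> Pa Pb; have [g [ag gA gab gP]] := homogeneous Pa Pb.
exists g; split=> //; last 2 first.
- move=> x y; split; first exact: (automorphism_definable2 ag _ lt_definable).
  have gR := automorphism_definable2 ag gA R_definable x y.
  split=> Exy; have [Px Py] := E_P Exy.
    by apply/(E_R ((gP x).1 Px) ((gP y).1 Py))/gR/E_R.
  by apply/(E_R ((gP x).2 Px) ((gP y).2 Py))/gR/E_R.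
- by move=> D; exact: automorphism_definable1.
- by move=> x; have [[g' _ g'K] _ _] := ag; exists (g' x).
Qed.

(** All points of [P] are conjugate over [A], so such a [D] contains all of [P] or none of it. *)
Lemma homogeneous_definable (B D : set C) x y :
  B `<=` A -> definable B (tuples1 D) -> P x -> P y -> D x -> D y.
Proof.
move=> BA dD Px Py Dx; have [g [<- _ _ _ gD]] := homogeneous_automorphism Px Py.
by apply: (gD D _ x).1 Dx; exact: definable_var1 BA dD.
Qed.

Lemma class_definable a : definable setT (tuples1 (R a)).
Proof.
have [t tE] := @constant_term _ C setT 1 a I.
rewrite (_ : tuples1 _ = [set e : 'I_1 -> C | R (eval_over t e)
    (eval_over (Var (expand_sig [set: C]) ord0) e)]).
  exact: definable_app2 (@subsetT _ _) R_definable.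
by rewrite predeqE => e; rewrite /= tE.
Qed.

(** Far up in the class of [a], [R a] agrees with a 0-definable [D0], which contains a point of [P]
    and therefore all of [P]. An automorphism taking [a] to [s] moves [x] into this range. *)
Lemma class_convex a b x : E a b -> P x -> lt a x -> lt x b -> E a x.
Proof.
have [lt_irr lt_tr lt_tot] := lt_order => Eab Px ax xb.
have [Pa Pb] := E_P Eab.
have [|D0 [dD0 [s Eas sD]]] :=
    definable_eventually lt_order C_qom (S := E a) _ (class_definable a).
  by exists a; exact: E_refl.
have [_ Ps] := E_P Eas.
have [g [gas _ gP gE _]] := homogeneous_automorphism Pa Ps.
have s_gb : lt s (g b) by rewrite -gas; apply/(gE a b).1; exact: lt_tr ax xb.
have E_gb : E a (g b).
  by apply: E_trans Eas _; rewrite -gas; exact/(gE a b).2.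
have Pgb := (E_P E_gb).2.
(* A second move produces a point of the class above [g b], so that [g b] too lies strictly inside
   the range of agreement. *)
have [g' [g'as _ _ g'E _]] := homogeneous_automorphism Pa Pgb.
have gb_g'b : lt (g b) (g' b).
  by rewrite -g'as; apply/(g'E a b).1; exact: lt_tr ax xb.
have E_g'b : E a (g' b).
  by apply: E_trans E_gb _; rewrite -g'as; exact/(g'E a b).2.
have D0gb : D0 (g b) by apply/(sD _ (g' b)) => //; exact/E_R.
apply/(gE a x).2; rewrite gas; apply: E_trans (E_sym Eas) _.
have Pgx := (gP x).1 Px.
apply/E_R => //; apply/(sD _ (g b)) => //.
- by rewrite -gas; exact/(gE a x).1.
- exact/(gE x b).1.
- exact: homogeneous_definable (@sub0set _ _) dD0 Pgb Pgx D0gb.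
Qed.

(** If one point is the maximum of its class, every point of [P] is, by homogeneity. *)
Lemma class_max_trivial a b c : P c -> (forall u, E c u -> ~ lt c u) ->
  E a b -> ~ lt a b.
Proof.
move=> Pc c_max Eab ab; have [g [ga _ _ gE _]] :=
  homogeneous_automorphism (E_P Eab).1 Pc.
by apply: (c_max (g b)); rewrite -ga; [apply/(gE a b).2|apply/(gE a b).1].
Qed.

Lemma class_min_trivial a b c : P c -> (forall u, E c u -> ~ lt u c) ->
  E a b -> ~ lt a b.
Proof.
move=> Pc c_min Eab ab; have [g [gb _ _ gE _]] :=
  homogeneous_automorphism (E_P Eab).2 Pc.
apply: (c_min (g a)); rewrite -gb; last exact/(gE a b).1.
exact/(gE b a).2/E_sym.
Qed.

(** Without such a [d], [R x] would agree with a 0-definable set between some [u] in the class and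
    some [v] beyond it. That set contains [u], hence [v] by homogeneity, which puts [v] into the
    class. *)
Lemma class_gap x y : P x -> P y -> lt x y -> ~ E x y ->
  exists d, (forall u, E x u -> ~ lt d u) /\
    (forall v, P v -> lt x v -> ~ E x v -> ~ lt v d).
Proof.
have [lt_irr lt_tr lt_tot] := lt_order => Px Py xy nExy.
pose V := [set v | [/\ P v, lt x v & ~ E x v]].
apply: contrapT => nod.
have [|||D0 [dD0 [u [v [Exu [Pv xv nExv] uvD]]]]] :=
    definable_gap lt_order C_qom (U := E x) (V := V) _ _ (class_definable x).
- by exists x; exact: E_refl.
- by exists y.
- move=> [d [xd dV]]; apply: nod; exists d; split=> // v Pv xv nExv.
  exact: dV.
have Pu := (E_P Exu).2.
have uv : lt u v.
  have [//|uv|vu] := lt_tot u v; first by case: nExv; rewrite -uv.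
  by case: nExv; exact: class_convex Exu Pv xv vu.
have le_vu : ~ lt v u by move=> vu; exact: lt_irr (lt_tr _ _ _ uv vu).
apply: nExv; apply/E_R => //; apply/(uvD v) => //.
apply: (homogeneous_definable (@sub0set _ _) dD0 Pu Pv).
by apply: (uvD u _ _).1 => //; exact: (E_R Px Pu).1.
Qed.

(** Agreement near the upper end of [P] spreads down: both sets are invariant under the automorphism
    that lifts [a] to [s]. *)
Lemma definable_hull (D : set C) : P !=set0 -> definable A (tuples1 D) ->
  exists D0, definable set0 (tuples1 D0) /\
    forall x a b, P a -> P b -> lt a x -> lt x b -> (D x <-> D0 x).
Proof.
move=> Pn0 dD.
have [|D0 [dD0 [s Ps sD]]] := definable_eventually lt_order C_qom (D := D) Pn0.
  exact: (definable_var1 _ (@subsetT _ A) dD).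
exists D0; split=> // x a b Pa Pb ax xb.
have [g [ga _ gP gE gD]] := homogeneous_automorphism Pa Ps.
rewrite (gD _ dD) (gD D0); last exact: (definable_var1 _ (@sub0set _ A) dD0).
apply: (sD _ (g b)); first exact: (gP b).1.
  by rewrite -ga; exact/(gE a x).1.
exact/(gE x b).1.
Qed.

Lemma separated_definable (D : set C) : definable set0 (tuples1 D) ->
  definable set0
    (tuples2 (fun a b => exists d, [/\ D d, lt a d & lt d b])).
Proof.
(* Variable 0 is the bound [d]; variables 1 and 2 are [a] and [b]. *)
move=> dD; pose i0 : 'I_3 := ord0; pose i1 := lift ord0 (ord0 : 'I_2).
pose i2 := lift ord0 (ord_max : 'I_2).
have dl i j := definable_var2 (k := 3) i j (@subset_refl _ set0) lt_definable.
have := definable_ex (definable_setI (definable_setI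
  (definable_var1 i0 (@subset_refl _ set0) dD) (dl i1 i0)) (dl i0 i2)).
congr definable; rewrite predeqE => e; rewrite /tuples2 /i0 /i1 /i2 /=.
split=> -[d]; rewrite /setI /=.
  by rewrite !env_cons0 !env_consS => -[[]]; exists d.
by move=> []; exists d; rewrite !env_cons0 !env_consS.
Qed.

Lemma equivalence_definable : exists R0 : C -> C -> Prop,
  definable set0 (tuples2 R0) /\ forall a b, P a -> P b -> (E a b <-> R0 a b).
Proof.
have [lt_irr lt_tr lt_tot] := lt_order.
have [full|] := pselect (forall a b, P a -> P b -> E a b).
  exists (fun _ _ => True); split=> [|a b Pa Pb]; first exact: definable_const.
  by split=> // _; exact: full.
move=> /existsNP[x /existsNP[y /not_implyP[Px /not_implyP[Py nExy]]]].
wlog xy : x y Px Py nExy / lt x y.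
  move=> H; have [xy|xy|yx] := lt_tot x y.
  - exact: H Px Py nExy xy.
  - by case: nExy; rewrite -xy; exact: E_refl.
  - by apply: H Py Px _ yx => /E_sym.
(* When all classes are singletons, [E] is equality on [P]. *)
have eq_case : (forall a b, E a b -> ~ lt a b) -> exists R0 : C -> C -> Prop,
    definable set0 (tuples2 R0) /\
    forall a b, P a -> P b -> (E a b <-> R0 a b).
  move=> Elt; exists eq; split=> [|a b Pa Pb]; first exact: definable_eq.
  split=> [Eab|<-]; last exact: E_refl.
  by have [/(Elt _ _ Eab)|//|/(Elt _ _ (E_sym Eab))] := lt_tot a b.
have [d [Ed dV]] := class_gap Px Py xy nExy.
(* A gap point in [P] is either the maximum of the class of [x] or the minimum of its own class;
   both make all classes singletons. *)
have [Pd|nPd] := pselect (P d).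
  apply: eq_case => a b; have [Exd|nExd] := pselect (E x d).
    by apply: class_max_trivial Pd _ => u Edu; apply: Ed; exact: E_trans Edu.
  have xd : lt x d.
    have [//|xd|dx] := lt_tot x d.
      by case: nExd; rewrite -xd; exact: E_refl.
    by case: (Ed x (E_refl Px)).
  apply: class_min_trivial Pd _ => u Edu ud; have Pu := (E_P Edu).2.
  have nExu : ~ E x u by move=> Exu; apply: nExd; exact: E_trans (E_sym Edu).
  have [xu|xu|ux] := lt_tot x u; first exact: dV Pu xu nExu ud.
    by apply: nExu; rewrite -xu; exact: E_refl.
  by apply: nExu; exact/E_sym/(class_convex (E_sym Edu) Px ux xd).
(* Otherwise [v], a point above [d], would be in the class of [x]: by the choice of [d] when [u] is
   above [x], by convexity when [u] is below [x]. *)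
have sep u v : P u -> P v -> lt u d -> lt d v -> ~ E u v.
  move=> Pu Pv ud dv Euv.
  have xv : lt x v.
    have [//|xv|vx] := lt_tot x v.
      by case: (Ed x (E_refl Px)); rewrite xv.
    by case: (Ed x (E_refl Px)); exact: lt_tr dv vx.
  have nExv : ~ E x v by move=> /Ed.
  have [xu|xu|ux] := lt_tot x u.
  - have [Exu|nExu] := pselect (E x u); last exact: dV Pu xu nExu ud.
    by apply: nExv; exact: E_trans Euv.
  - by apply: nExv; rewrite xu.
  - by apply: nExv; apply: E_trans (Euv);
      exact/E_sym/(class_convex Euv Px ux xv).
have [|T [dT PT Td]] := compactness (d := d).
  by move=> u v Pu Pv [ud dv /E_R Euv]; exact: sep ud dv (Euv Pu Pv).
(* Replacing [P] by the definable [T] makes the separation property of [d] first-order over [A], so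
   it passes to conjugates of [d]. *)
pose D := [set z | forall u v, T u -> T v -> ~ [/\ lt u z, lt z v & R u v]].
have dD : definable A (tuples1 D).
  (* Variable 2 is [z]; [u] and [v] are the bound variables 1 and 0. *)
  pose i0 : 'I_3 := ord0; pose i1 := lift ord0 (ord0 : 'I_2).
  pose i2 := lift ord0 (ord_max : 'I_2).
  have AA := @subset_refl _ A.
  have dl i j := definable_var2 (k := 3) i j (@sub0set _ A) lt_definable.
  have := definable_all (definable_all (definable_imp (definable_var1 i1 AA dT)
    (definable_imp (definable_var1 i0 AA dT) (definable_setC
    (definable_setI (definable_setI (dl i1 i2) (dl i2 i0))
      (definable_var2 i1 i0 AA R_definable)))))).
  congr definable; rewrite predeqE => e; rewrite /tuples1 /D /i0 /i1 /i2 /=.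
  have -> : ord_max = lift ord0 ord0 :> 'I_2 by exact/val_inj.
  split=> H u v; have := H u v; rewrite /setI /= !env_cons0 !env_consS !env_cons0.
    by move=> H' Tu Tv [uz zv Ruv]; apply: H'.
  by move=> H' Tu Tv [[uz zv] Ruv]; apply: H'.
have [|D0 [dD0 DD0]] := definable_hull _ dD; first by exists x.
pose sep0 a b := exists z, [/\ D0 z, lt a z & lt z b].
have sepE a b : P a -> P b -> lt a b -> (E a b <-> ~ sep0 a b).
  move=> Pa Pb ab; split=> [Eab [z [D0z az zb]]|nsep].
    have Dz : D z by exact/(DD0 z a b).
    by apply: (Dz a b) => //; [exact: PT|exact: PT|split=> //; exact/E_R].
  apply: contrapT => nEab.
  (* The separating point is [g d]. Pulled back by [g], the task is to place [d] strictly between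
     [x] and [b']; strictness comes from [d] lying outside [P]. *)
  have [g [gx g_surj gP gE gD]] := homogeneous_automorphism Px Pa.
  have [b' b'E] := g_surj b; rewrite -b'E -gx in Pb ab nEab nsep.
  have Pb' := (gP b').2 Pb.
  have xb' : lt x b' by exact/(gE x b').1.
  have nExb' : ~ E x b' by move=> /(gE x b').2.
  have xd : lt x d.
    have [//|xd|dx] := lt_tot x d; first by case: nPd; rewrite -xd.
    by case: (Ed x (E_refl Px)).
  have db' : lt d b'.
    have [//|db|bd] := lt_tot d b'; first by case: nPd; rewrite db.
    by case: (dV b').
  apply: nsep; exists (g d); split; [|exact/(gE x d).1|exact/(gE d b').1].
  apply/(DD0 _ (g x) (g b')) => //; [exact: (gP x).1|exact/(gE x d).1
    |exact/(gE d b').1|exact: (gD _ dD d).1].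
(* Both orders of the pair are covered; the condition for the wrong order holds vacuously. *)
exists (fun a b => ~ sep0 a b /\ ~ sep0 b a); split.
  apply: definable_setI; apply: definable_setC; first exact: separated_definable.
  exact: (definable_var2 ord_max ord0 (@subset_refl _ set0)
    (separated_definable dD0)).
have nsep0 a b : ~ lt a b -> ~ sep0 a b.
  by move=> ab [z [_ az zb]]; apply: ab; exact: lt_tr az zb.
move=> a b Pa Pb; have [ab|<-|ba] := lt_tot a b.
- rewrite sepE //; split=> [nab|[]//]; split=> //; apply: nsep0 => ba.
  exact: lt_irr (lt_tr _ _ _ ab ba).
- split=> _; last exact: E_refl.
  by split; apply: nsep0; exact: lt_irr.
- have -> : E a b <-> E b a by split=> /E_sym.
  rewrite sepE //; split=> [nba|[]//]; split=> //; apply: nsep0 => ab.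
  exact: lt_irr (lt_tr _ _ _ ab ba).
Qed.

End ConvexEquivalence.

(** * Application to the realizations of a complete type in the monster model *)

Theorem proposition4p1 (L : signature) (T : theory L) (kappa : Type)
    (C : structure L) :
  complete_theory T ->
  monster_model kappa T C ->
  quasi_o_minimal C ->
  condition_R kappa C.
Proof.
move=> _ [_ [Fk _] C_sat C_hom] [lt [lt_order lt_def C_qom]].
move=> A Ak p p_complete E [E_equiv [phi phiE]].
have kinf : infinite_set [set: kappa].
  (* There are infinitely many formulas, already one falsum for each number of variables, and
     [kappa] exceeds their number. *)
  apply/infiniteP; apply: card_le_trans Fk.
  rewrite -(card_le_eql (inj_card_eq (A := [set: nat])
    (f := fun n => existT (formula L) n (Fls L n)) _)).
    exact: card_leT.
  by move=> m n _ _ /(congr1 (@projT1 _ _)).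
pose R a b := sat_over phi (pair_env a b).
have phiR : [set e | sat_over phi e] = tuples2 R.
  by rewrite predeqE => e; rewrite /= {1}(pair_envE e).
have R_def : definable A (tuples2 R) by exists phi; rewrite phiR.
have E_R a b : realizes p a -> realizes p b -> (E a b <-> R a b).
  move=> pa pb; have := congr1 (@^~ (pair_env a b)) phiE.
  rewrite phiR /tuples2 /setI /= pair_env0 pair_env_max => ->.
  split=> [[]//|Rab]; split=> // i; rewrite /pair_env /env_cons.
  by case: unlift.
have Aak a : small kappa (A `|` [set a]) by exact: small_setU1.
have homogeneous a b : realizes p a -> realizes p b ->
    exists g, [/\ automorphism g, forall c, A c -> g c = c, g a = b &
      forall x, realizes p x <-> realizes p (g x)].
  move=> pa pb.
  have [g [ag gA gab]] := type_homogeneous C_hom (Aak a) p_complete pa pb.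
  exists g; split=> // x.
  by split=> H psi /H; [move/(automorphism_sat_over _ _ ag gA)|
    move=> psi_gx; apply/(automorphism_sat_over _ _ ag gA)].
have compactness d :
    (forall a b, realizes p a -> realizes p b ->
      ~ [/\ lt a d, lt d b & R a b]) ->
    exists D, [/\ definable A (tuples1 D), realizes p `<=` D &
      forall a b, D a -> D b -> ~ [/\ lt a d, lt d b & R a b]].
  (* The relation to be excluded mentions [d], which therefore joins the parameters, while the
     resulting set is definable over [A] alone. *)
  move=> pd; apply: (type_compactness C_sat (B := A `|` [set d])) => //.
    have [t tE] := @constant_term _ _ (A `|` [set d]) 2 d (or_intror erefl).
    pose x i : term (expand_sig (A `|` [set d])) 2 := Var _ i.
    have := definable_setI (definable_setI
      (definable_app2 (x ord0) t (@sub0set _ _) lt_def)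
      (definable_app2 t (x ord_max) (@sub0set _ _) lt_def))
      (definable_app2 (x ord0) (x ord_max) (@subsetUl _ A _) R_def).
    congr definable; rewrite predeqE => e; rewrite /setI /tuples2 /= tE.
    by split=> [[[]]|[]].
  by move=> b; exact: small_setU1.
have [R0 [R0_def ER0]] := equivalence_definable lt_order lt_def C_qom
  homogeneous R_def E_equiv E_R compactness.
have [psi psiE] := R0_def; exists psi; rewrite -psiE predeqE => e.
split=> [Ee|[R0e pe]]; last exact/ER0.
have [E_P _ _ _] := E_equiv; have [p0 p1] := E_P _ _ Ee.
split; first exact/ER0.
move=> i; rewrite (pair_envE e) /pair_env /env_cons.
by case: unlift.
Qed.
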